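(* Let $(\mathbf y_\gamma,u_\gamma,w_\gamma)$ be a sequence (indexed by the regularization parameter $\gamma\to\infty$) of solutions of the regularized problems $$\min_{(\mathbf y,u,w)}J_\gamma(\mathbf y,u,w)\quad\text{subject to}\quad e(\mathbf y,u)=0,$$ where $\mathbf y_\gamma$ satisfies $e(\mathbf y_\gamma,u_\gamma)=0$. Furthermore, let $(\mathbf y,u,w)$ be a global solution of the problem $$\min_{(\mathbf y,u,w)}J(\mathbf y,u,w)\quad\text{subject to}\quad e(\mathbf y,u)=0 .$$ Then there exists a subsequence $(\mathbf y_{\gamma_k},u_{\gamma_k},w_{\gamma_k})$ such that $$(\mathbf y_{\gamma_k},u_{\gamma_k},w_{\gamma_k})\to(\mathbf y,u,w)\quad\text{for }k\to\infty .$$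
   Context: Discretized Burgers equation. The inviscid Burgers equation $\partial_ty+y\,\partial_xy=f$ with $y=0$ on the boundary and initial condition $u$ is discretized with $n$ spatial points $x_i=ih$, $h=1/(n+1)$, and $N_t$ time points, $\Delta t=1/(N_t+1)$; $m=nN_t$. Vectors of $\mathbb R^m$ are written $\mathbf y=(y^1,\dots,y^{N_t})$ with $y^j\in\mathbb R^n$. $U\in\mathbb R^{n\times n}$ is the matrix of the standard forward finite difference scheme for the first spatial derivative. The state operator is $e(\mathbf y,u)=\mathbb E\mathbf y+\mathbb Z(\mathbf y)\mathbb U\mathbf y-\mathbf f(u)$, $e:\mathbb R^m\times\mathbb R^n\to\mathbb R^m$, where $\mathbb E$ is block lower bidiagonal with diagonal blocks $\frac1{\Delta t}\mathbb I$ and subdiagonal blocks $-\frac1{\Delta t}\mathbb I$; $\mathbb U=\mathrm{blockdiag}(0,U,\dots,U)$; $\mathbb Z(\mathbf y)=\mathrm{blockdiag}(0,\mathrm{diag}(y^1),\dots,\mathrm{diag}(y^{N_t-1}))$; $\mathbf f(u)=(u/\Delta t,f^2,\dots,f^{N_t})$ with given $f^j\in\mathbb R^n$. Cost functionals. $S\in\mathbb R^{m_o\times n_oN_t}$, $H\in\mathbb R^{n_oN_t\times m}$, $\mathbf z\in\mathbb R^{m_o}$, $u^b\in\mathbb R^n$ are given, $R$ and $B$ are symmetric positive definite covariance matrices, $\alpha,\beta,\mu>0$. $D\in\mathbb R^{(n-1)\times n}$ is the discrete gradient matrix of forward finite differences and $E\in\mathbb R^{(n-1)\times(n-1)}$ that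 of backward finite differences, with rows $D_i$, $E_i$. For $(\mathbf y,u,w)\in\mathbb R^m\times\mathbb R^n\times\mathbb R^{n-1}$, $$J(\mathbf y,u,w)=\tfrac12(SH\mathbf y-\mathbf z)^TR^{-1}(SH\mathbf y-\mathbf z)+\tfrac\mu2w^Tw+\tfrac12(u-u^b)^TB^{-1}(u-u^b)+\alpha\sum_{i=1}^{n-1}|D_iu-w_i|+\beta\sum_{i=1}^{n-1}|E_iw|,$$ and $J_\gamma$ is obtained from $J$ by replacing $|D_iu-w_i|$ and $|E_iw|$ by $H_\gamma(D_iu-w_i)$ and $H_\gamma(E_iw)$, where $H_\gamma$ is the $C^2$ Huber function $$H_\gamma(t)=\begin{cases}|t|+C_1+K&\text{if }\gamma|t|\ge1+\frac1{2\gamma},\\ \frac\gamma2t^2&\text{if }\gamma|t|\le1-\frac1{2\gamma},\\ F|t|+\frac G2|t|^2+\frac C3|t|^3+D_0&\text{if }|\gamma|t|-1|\le\frac1{2\gamma},\end{cases}$$ with $l_1=\frac1\gamma(1-\frac1{2\gamma})$, $l_2=\frac1\gamma(1+\frac1{2\gamma})$, $F=1-\frac{(2\gamma+1)^2}{8\gamma}$, $G=\frac\gamma2(2\gamma+1)$, $C=-\frac{\gamma^3}2$, $D_0=(\frac\gamma2-\frac G2)l_1^2-F|l_1|-\frac C3|l_1|^3$, $C_1=\frac\gamma2l_1^2-l_2$, $K=F(l_2-l_1)+\frac G2(l_2^2-l_1^2)+\frac C3(l_2^3-l_1^3)$.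
   Formalization: Added: the norms of the states y_γ do not tend to infinity. The subsequence converges to some global solution, and to the given (y,u,w) only if it is the unique global solution; as worded, the claim fails when minimizers are non-unique or states are unbounded. *)

(* Defs.v *)
From HB Require Import structures.
From mathcomp Require Import all_boot all_order all_algebra.
From mathcomp Require Import all_classical all_reals all_analysis.

Set Implicit Arguments.
Unset Strict Implicit.
Unset Printing Implicit Defensive.

Import Order.TTheory GRing.Theory Num.Theory.
Import numFieldNormedType.Exports.

Local Open Scope classical_set_scope.
Local Open Scope ring_scope.

Definition space_step (R : realType) (n : nat) : R := n.+1%:R^-1.
Definition time_step (R : realType) (Nt : nat) : R := Nt.+1%:R^-1.

(* Forward differences on the interior nodes: (U v)_i = (v_(i+1) - v_i) / h, with
   the boundary value v_(n+1) = 0 eliminated, whence the last row of U. *)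
Definition fwd_diff (R : realType) (n : nat) : 'M[R]_n :=
  \matrix_(i, j) (((j == i.+1 :> nat)%:R - (j == i)%:R) / space_step R n).

(* A vector of R^m, m = n * Nt, is kept in block form: its length is written
   \sum_(j < Nt) n, so that submxcol y j is the time block number j. Blocks are
   numbered from 0: block j is y^(j+1) in the usual numbering from 1. *)
Notation state R n Nt := 'cV[R]_(\sum_(j < Nt) n).

Definition time_mx (R : realType) (n Nt : nat) :
    'M[R]_(\sum_(j < Nt) n, \sum_(j < Nt) n) :=
  \mxblock_(i < Nt, j < Nt)
    (if i == j then (time_step R Nt)^-1%:M
     else if (i == j.+1 :> nat) then (- (time_step R Nt)^-1)%:M
     else 0 : 'M[R]_n).

Definition space_mx (R : realType) (n Nt : nat) :
    'M[R]_(\sum_(j < Nt) n, \sum_(j < Nt) n) :=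
  \mxdiag_(j < Nt) (if j == 0 :> nat then 0 else fwd_diff R n).

(* ord_pred j is j - 1 for j > 0; its wrap-around value at 0 is never used. *)
Definition transport_mx (R : realType) (n Nt : nat) (y : state R n Nt) :
    'M[R]_(\sum_(j < Nt) n, \sum_(j < Nt) n) :=
  \mxdiag_(j < Nt)
    (if j == 0 :> nat then 0 else diag_mx (submxcol y (ord_pred j))^T).

(* The first block of f is not used: it is replaced by u / dt. *)
Definition source (R : realType) (n Nt : nat) (f : 'I_Nt -> 'cV[R]_n)
    (u : 'cV[R]_n) : state R n Nt :=
  \mxcol_(j < Nt) (if j == 0 :> nat then (time_step R Nt)^-1 *: u else f j).

Definition state_op (R : realType) (n Nt : nat) (f : 'I_Nt -> 'cV[R]_n)
    (y : state R n Nt) (u : 'cV[R]_n) : state R n Nt :=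
  time_mx R n Nt *m y + transport_mx y *m (space_mx R n Nt *m y) - source f u.

Definition grad_fwd (R : realType) (n : nat) : 'M[R]_(n.-1, n) :=
  \matrix_(i, j)
    (((j == i.+1 :> nat)%:R - (j == i :> nat)%:R) / space_step R n).

(* Square, so that the first row uses the value w_0 = 0. *)
Definition grad_bwd (R : realType) (n : nat) : 'M[R]_(n.-1) :=
  \matrix_(i, j) (((j == i)%:R - (j.+1 == i :> nat)%:R) / space_step R n).

Definition sym_posdef (R : realType) (n : nat) (M : 'M[R]_n) : Prop :=
  M^T = M /\ forall x : 'cV[R]_n, x != 0 -> 0 < (x^T *m M *m x) 0 0.

Section Huber.
Variables (R : realType) (g : R).

Definition hub_l1 : R := g^-1 * (1 - (2 * g)^-1).
Definition hub_l2 : R := g^-1 * (1 + (2 * g)^-1).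
Definition hub_F : R := 1 - (2 * g + 1) ^+ 2 / (8 * g).
Definition hub_G : R := g / 2 * (2 * g + 1).
Definition hub_C : R := - (g ^+ 3 / 2).
Definition hub_D0 : R :=
  (g / 2 - hub_G / 2) * hub_l1 ^+ 2 - hub_F * `|hub_l1|
  - hub_C / 3 * `|hub_l1| ^+ 3.
Definition hub_C1 : R := g / 2 * hub_l1 ^+ 2 - hub_l2.
Definition hub_K : R :=
  hub_F * (hub_l2 - hub_l1) + hub_G / 2 * (hub_l2 ^+ 2 - hub_l1 ^+ 2)
  + hub_C / 3 * (hub_l2 ^+ 3 - hub_l1 ^+ 3).

(* The closed ranges of the three cases overlap only where the corresponding
   formulas agree; the last case is | g|t| - 1 | < 1/(2g). *)
Definition huber (t : R) : R :=
  if 1 + (2 * g)^-1 <= g * `|t| then `|t| + hub_C1 + hub_K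
  else if g * `|t| <= 1 - (2 * g)^-1 then g / 2 * t ^+ 2
  else hub_F * `|t| + hub_G / 2 * `|t| ^+ 2 + hub_C / 3 * `|t| ^+ 3 + hub_D0.

End Huber.

(* phi is the absolute value for J and huber gamma for J_gamma. *)
Definition cost (R : realType) (phi : R -> R) (n Nt mo no : nat)
    (Sobs : 'M[R]_(mo, no * Nt)) (H : 'M[R]_(no * Nt, \sum_(j < Nt) n))
    (z : 'cV[R]_mo) (Rcov : 'M[R]_mo) (ub : 'cV[R]_n) (Bcov : 'M[R]_n)
    (alpha beta mu : R)
    (y : state R n Nt) (u : 'cV[R]_n) (w : 'cV[R]_(n.-1)) : R :=
  2^-1 * ((Sobs *m H *m y - z)^T *m invmx Rcov *m (Sobs *m H *m y - z)) 0 0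
  + mu / 2 * (w^T *m w) 0 0
  + 2^-1 * ((u - ub)^T *m invmx Bcov *m (u - ub)) 0 0
  + alpha * (\sum_(i < n.-1) phi ((grad_fwd R n *m u) i 0 - w i 0))
  + beta * (\sum_(i < n.-1) phi ((grad_bwd R n *m w) i 0)).

Definition global_solution (R : realType) (Y U W : Type)
    (J : Y -> U -> W -> R) (feasible : Y -> U -> Prop) (y : Y) (u : U) (w : W) :
    Prop :=
  feasible y u /\ forall y' u' w', feasible y' u' -> J y u w <= J y' u' w'.

(* Main.v *)
Require Import Defs.
From HB Require Import structures.
From mathcomp Require Import all_boot all_order all_algebra.
From mathcomp Require Import all_classical all_reals all_analysis.
From mathcomp Require Import ring lra.

Set Implicit Arguments.
Unset Strict Implicit.
Unset Printing Implicit Defensive.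

Import Order.TTheory GRing.Theory Num.Theory.
Import numFieldNormedType.Exports.

Local Open Scope classical_set_scope.
Local Open Scope ring_scope.

(** The Huber function stays within 1/gamma of the absolute value, uniformly in
    its argument ([huber_dist]), so J_gamma and J differ by O(1/gamma)
    uniformly over all states, controls and auxiliary variables ([cost_dist]).
    A minimizer of J_gamma is therefore a minimizer of J up to an error
    O(1/gamma) ([huber_minimizer_quasi_minimizer]).

    Comparing with one fixed feasible point bounds J along the sequence.  The
    terms w^T w and (u - ub)^T B^-1 (u - ub) then bound w and u
    ([cost_coercive]), and the states are bounded along a subsequence because
    their norms do not tend to infinity.  Bolzano-Weierstrass
    ([bounded_mx_subsequence]) extracts a convergent subsequence.  Since the
    state operator is polynomial and J is continuous ([cvg_state_op],
    [cvg_cost]), the limit is feasible, and letting gamma tend to infinity in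
    the approximate minimality shows that it minimizes J.  When J has a single
    global minimizer, that minimizer has to be the limit. *)

(** * Extraction of subsequences *)

Lemma increasing_extraction (P : nat -> Prop) :
  (forall N, exists2 k, (N < k)%N & P k) ->
  exists s : nat -> nat, {homo s : i j / (i < j)%N} /\ forall k, P (s k).
Proof.
move=> /(_ _)/cid2 /= inf; pose next N := s2val (inf N).
exists (fun k => iter k.+1 next 0%N); split=> [|k].
  by apply: (homo_ltn ltn_trans) => i; exact: (s2valP (inf _)).
exact: (s2valP' (inf _)).
Qed.

Lemma homo_ltn_cvg_infty (s : nat -> nat) :
  {homo s : i j / (i < j)%N} -> s @ \oo --> \oo.
Proof.
move=> hs A [N _ NA]; exists N => // k /= Nk; apply: NA => /=.
apply: leq_trans Nk _; elim: k => // k ih.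
exact: leq_ltn_trans ih (hs _ _ (ltnSn k)).
Qed.

(** One coordinate at a time: a further extraction does not destroy the
    convergence obtained for the previous coordinates. *)
Lemma bounded_family_subsequence (R : realType) (I : finType)
    (x : nat -> I -> R) (M : I -> R) :
  (forall k i, `|x k i| <= M i) ->
  exists2 s : nat -> nat, {homo s : i j / (i < j)%N} &
    forall i, cvgn (fun k => x (s k) i).
Proof.
move=> xM.
suff: forall r : seq I, exists2 s : nat -> nat, {homo s : i j / (i < j)%N} &
    forall i, i \in r -> cvgn (fun k => x (s k) i).
  by move=> /(_ (enum I))[s hs cs]; exists s => // i; apply: cs; rewrite mem_enum.
elim=> [|i r [s hs cs]]; first by exists id.
have [|t ht ct] := @bolzano_weierstrass R (fun k => x (s k) i).
  exists (M i); split; first exact: num_real.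
  by move=> b /ltW Mb k _; exact: le_trans (xM _ _) Mb.
have {}ht : {homo t : i j / (i < j)%N}.
  by move=> a b; rewrite (leqW_mono ht).
exists (s \o t) => [a b /ht/hs //|j]; rewrite in_cons => /predU1P[->|/cs js].
  exact: ct.
have := cvg_comp _ _ (homo_ltn_cvg_infty ht) js.
by move/cvgP.
Qed.

(** * Convergence of matrices *)

Section matrix_convergence.
Context {R : realType} {T : Type} {F : set_system T} {FF : Filter F}.

Lemma cvg_mxP m n (f : T -> 'M[R]_(m, n)) (M : 'M[R]_(m, n)) :
  (f @ F --> M) <-> (forall i j, f x i j @[x --> F] --> M i j).
Proof.
split=> [fM i j|fM A [P MP PA]].
  exact: (cvg_comp _ _ fM (@coord_continuous R m n i j M)).
apply: (@filterS T F _ (fun x => forall i j, P i j (f x i j))) => [x Px|].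
  exact: PA.
by apply: filter_forall => i; apply: filter_forall => j; exact: fM.
Qed.

Lemma cvg_mulmx m n p (f : T -> 'M[R]_(m, n)) (g : T -> 'M[R]_(n, p))
    (M : 'M[R]_(m, n)) (N : 'M[R]_(n, p)) :
  f @ F --> M -> g @ F --> N -> f x *m g x @[x --> F] --> M *m N.
Proof.
move=> /cvg_mxP fM /cvg_mxP gN; apply/cvg_mxP => i j.
rewrite mxE; under eq_fun do rewrite mxE.
apply: cvg_big => [|k _]; first exact: add_continuous.
by apply: cvgM; [exact: fM | exact: gN].
Qed.

Lemma cvg_trmx m n (f : T -> 'M[R]_(m, n)) (M : 'M[R]_(m, n)) :
  f @ F --> M -> (f x)^T @[x --> F] --> M^T.
Proof.
move=> /cvg_mxP fM; apply/cvg_mxP => i j.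
by rewrite mxE; under eq_fun do rewrite mxE; exact: fM.
Qed.

Lemma cvg_quadratic_form n (A : 'M[R]_n) (f : T -> 'cV[R]_n) (v : 'cV[R]_n) :
  f @ F --> v ->
  ((f x)^T *m A *m f x) 0 0 @[x --> F] --> (v^T *m A *m v) 0 0.
Proof.
move=> fv; suff /cvg_mxP : (f x)^T *m A *m f x @[x --> F] --> v^T *m A *m v by [].
apply: cvg_mulmx => //; apply: cvg_mulmx; [exact: cvg_trmx | exact: cvg_cst].
Qed.

End matrix_convergence.

Lemma bounded_mx_subsequence (R : realType) (m n : nat)
    (x : nat -> 'M[R]_(m, n)) (M : 'I_m -> 'I_n -> R) :
  (forall k i j, `|x k i j| <= M i j) ->
  exists2 s : nat -> nat, {homo s : i j / (i < j)%N} & cvgn (x \o s).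
Proof.
move=> xM.
have [|s hs cs] := @bounded_family_subsequence R ('I_m * 'I_n)%type
  (fun k ij => x k ij.1 ij.2) (fun ij => M ij.1 ij.2).
  by move=> k ij; exact: xM.
exists s => //; apply/cvg_ex.
exists (\matrix_(i, j) limn (fun k => x (s k) i j)); apply/cvg_mxP => i j.
by rewrite mxE; exact: (cs (i, j)).
Qed.

(** * Positive definite quadratic forms *)

Section positive_definite.
Context {R : realType} {n : nat}.
Variable B : 'M[R]_n.
Hypothesis hB : sym_posdef B.

Lemma sym_posdef_unit : B \in unitmx.
Proof.
rewrite -row_free_unit -kermx_eq0; apply: contraT => /rowV0Pn[v].
move=> /sub_kermxP vB v0; have := hB.2 v^T.
by rewrite trmxK vB mul0mx mxE ltxx => /(_ _); rewrite trmx_eq0 => /(_ v0).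
Qed.

Lemma sym_posdef_ge0 (v : 'cV[R]_n) : 0 <= (v^T *m B *m v) 0 0.
Proof.
have [->|v0] := eqVneq v 0; first by rewrite mulmx0 mxE.
exact/ltW/(hB.2 _ v0).
Qed.

(** The substitution x = B v reduces every estimate on the form of B^-1 to one on
    the form of B. *)
Lemma invmx_formE (x : 'cV[R]_n) (v := invmx B *m x) :
  (x^T *m invmx B *m x) 0 0 = (v^T *m B *m v) 0 0.
Proof.
have -> : x = B *m v by rewrite mulmxA mulmxV ?mul1mx // sym_posdef_unit.
rewrite trmx_mul hB.1 -!mulmxA (mulmxA (invmx B)) mulVmx ?mul1mx//.
exact: sym_posdef_unit.
Qed.

Lemma sym_posdef_diag_gt0 i : 0 < B i i.
Proof.
pose e : 'cV[R]_n := delta_mx i 0.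
have <- : (e^T *m B *m e) 0 0 = B i i by rewrite trmx_delta -rowE -colE !mxE.
apply: hB.2; apply/eqP => /matrixP/(_ i 0)/eqP.
by rewrite !mxE !eqxx oner_eq0.
Qed.

Lemma invmx_form_ge0 (x : 'cV[R]_n) : 0 <= (x^T *m invmx B *m x) 0 0.
Proof. by rewrite invmx_formE sym_posdef_ge0. Qed.

(** Coercivity of the form of B^-1, as the Cauchy-Schwarz inequality for the
    scalar product given by B: with v = B^-1 x, the entry x_i is the product of
    v with the basis vector e_i, whose square length is B_ii. *)
Lemma entry_sqr_le_invmx_form (x : 'cV[R]_n) i :
  x i 0 ^+ 2 <= B i i * (x^T *m invmx B *m x) 0 0.
Proof.
rewrite invmx_formE; set v := invmx B *m x.
have xE : x = B *m v by rewrite mulmxA mulmxV ?mul1mx // sym_posdef_unit.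
pose e : 'cV[R]_n := delta_mx i 0.
have eBe : (e^T *m B *m e) 0 0 = B i i.
  by rewrite trmx_delta -rowE -colE !mxE.
have eBv : (e^T *m B *m v) 0 0 = x i 0.
  by rewrite trmx_delta -mulmxA -xE -rowE mxE.
have vBe : (v^T *m B *m e) 0 0 = x i 0.
  by rewrite -colE -{1}hB.1 -trmx_mul -xE !mxE.
have Bi_gt0 := sym_posdef_diag_gt0 i.
(* B_ii v - x_i e_i is B_ii times the component of v orthogonal to e_i. *)
have := sym_posdef_ge0 (B i i *: v - x i 0 *: e).
rewrite [(_ - _)^T]linearB/= ![(_ *: _)^T]linearZ/= mulmxBr !mulmxBl.
rewrite -!scalemxAl -!scalemxAr.
move: (v^T *m B *m v) (e^T *m B *m v) (v^T *m B *m e) (e^T *m B *m e) eBe eBv vBe.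
move=> q b c d dE bE cE; rewrite !mxE dE bE cE => h.
rewrite -subr_ge0 -(pmulr_rge0 _ Bi_gt0); apply: le_trans h _.
by rewrite le_eqVlt; apply/orP; left; apply/eqP; ring.
Qed.

End positive_definite.

(** * The regularized absolute value *)

(** The outer branch is |t| shifted by this constant, of order 1/g. *)
Lemma hub_affineE (R : realType) (g : R) : g != 0 ->
  hub_C1 g + hub_K g = - (g^-1 / 2 + g^-1 ^+ 3 / 24).
Proof.
move=> g0.
by rewrite /hub_C1 /hub_K /hub_F /hub_G /hub_C /hub_l1 /hub_l2; field.
Qed.

(** The middle branch meets the outer one at l2 with equal value, slope and
    (zero) second derivative, so the two cubics in s differ by a multiple of
    (l2 - s)^3; the bracket below is g (l2 - s). *)
Lemma hub_cubicE (R : realType) (g s : R) : 1 <= g ->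
  hub_F g * s + hub_G g / 2 * s ^+ 2 + hub_C g / 3 * s ^+ 3 + hub_D0 g =
  s + (hub_C1 g + hub_K g) + (g^-1 / 2 - (g * s - 1)) ^+ 3 / 6.
Proof.
move=> g1; have g0 : g != 0 by rewrite gt_eqF//; lra.
have l1_ge0 : 0 <= hub_l1 g.
  have g1' : g^-1 <= 1 by rewrite invf_le1//; lra.
  rewrite /hub_l1 invfM mulr_ge0 ?invr_ge0//; lra.
rewrite hub_affineE// /hub_D0 (ger0_norm l1_ge0).
by rewrite /hub_F /hub_G /hub_C /hub_l1; field.
Qed.

(** Every branch lies below |t|, by at most the shift g^-1/2 + g^-3/24 of the outer
    one, and this shift is at most g^-1 once g >= 1. *)
Lemma huber_dist (R : realType) (g t : R) :
  1 <= g -> `|huber g t - `|t| | <= g^-1.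
Proof.
move=> g1; have g0 : 0 < g by lra.
have h0 : 0 < g^-1 by rewrite invr_gt0.
have h1 : g^-1 <= 1 by rewrite invf_le1.
have h2 : (2 * g)^-1 = g^-1 / 2 by rewrite invfM mulrC.
have h3 : 0 < g^-1 ^+ 3 <= g^-1.
  by rewrite exprn_gt0//= exprS ger_pMr// expr_le1// ltW.
have aff := hub_affineE (lt0r_neq0 g0).
have t0 : 0 <= `|t| by [].
rewrite ler_norml /huber -[t ^+ 2]real_normK ?num_real//.
move: `|t| t0 => s s0.
case: (lerP (1 + (2 * g)^-1) (g * s)) => [_|lt_l2]; first lra.
case: (lerP (g * s) (1 - (2 * g)^-1)) => [le_l1|gt_l1].
  have sg : s <= g^-1.
    by rewrite -(ler_pM2l g0) divff ?gt_eqF// (le_trans le_l1)// h2; lra.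
  have -> : g / 2 * s ^+ 2 - s = - (s * (1 - g * s / 2)) by field.
  have gs0 : 0 <= g * s by rewrite mulr_ge0// ltW.
  have ? : 0 <= s * (1 - g * s / 2) by rewrite mulr_ge0//; lra.
  have ? : s * (1 - g * s / 2) <= s by rewrite ler_piMr//; lra.
  lra.
rewrite hub_cubicE//; set d := g^-1 / 2 - (g * s - 1).
have d0 : 0 <= d by rewrite /d; lra.
have d1 : d <= g^-1 by rewrite /d; lra.
have d3 : 0 <= d ^+ 3 <= g^-1 ^+ 3.
  by rewrite exprn_ge0//= lerXn2r// nnegrE ltW.
lra.
Qed.

Lemma cost_dist (R : realType) (phi psi : R -> R) (e : R) (n Nt mo no : nat)
    (Sobs : 'M[R]_(mo, no * Nt)) (H : 'M[R]_(no * Nt, \sum_(j < Nt) n))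
    (z : 'cV[R]_mo) (Rcov : 'M[R]_mo) (ub : 'cV[R]_n) (Bcov : 'M[R]_n)
    (alpha beta mu : R) y u w :
  0 <= alpha -> 0 <= beta -> (forall t, `|phi t - psi t| <= e) ->
  `|cost phi Sobs H z Rcov ub Bcov alpha beta mu y u w -
    cost psi Sobs H z Rcov ub Bcov alpha beta mu y u w| <=
  (alpha + beta) * n.-1%:R * e.
Proof.
move=> a0 b0 he.
have sum_dist (x : 'I_n.-1 -> R) :
    `|\sum_i phi (x i) - \sum_i psi (x i)| <= n.-1%:R * e.
  rewrite -sumrB; apply: le_trans (ler_norm_sum _ _ _) _.
  apply: le_trans (ler_sum _ (fun i _ => he _)) _.
  by rewrite sumr_const card_ord mulr_natl.
rewrite /cost.
set A := 2^-1 * _; set B := mu / 2 * _; set C := 2^-1 * _.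
have := sum_dist (fun i => (grad_fwd R n *m u) i 0 - w i 0).
have := sum_dist (fun i => (grad_bwd R n *m w) i 0).
set s1 := \sum_i _; set s2 := \sum_i _; set s3 := \sum_i _; set s4 := \sum_i _.
move=> h12 h34.
have -> : A + B + C + alpha * s3 + beta * s1 - (A + B + C + alpha * s4 + beta * s2)
  = alpha * (s3 - s4) + beta * (s1 - s2) by ring.
rewrite (le_trans (ler_normD _ _))// !normrM (ger0_norm a0) (ger0_norm b0).
by rewrite mulrDl mulrDl -!mulrA lerD// ler_wpM2l.
Qed.

(** * Continuity of the cost and of the state operator *)

Section continuity.
Context {R : realType} {T : Type} {F : set_system T} {FF : Filter F}.
Variables (n Nt : nat).

Lemma transport_mxE (y : state R n Nt) i j :
  transport_mx y i j =
  if (tagnat.sig1 i == tagnat.sig1 j) && (tagnat.sig1 i != 0 :> nat) then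
    submxcol y (ord_pred (tagnat.sig1 i)) (tagnat.sig2 i) 0 *+
      (tagnat.sig2 i == tagnat.sig2 j :> 'I_n)
  else 0.
Proof.
rewrite mxE; case: eqP => [_|_] /=; last by rewrite mxE.
by rewrite conform_mx_id; case: (_ == 0)%N; rewrite !mxE.
Qed.

Lemma cvg_transport_mx (y : T -> state R n Nt) (yl : state R n Nt) :
  y @ F --> yl -> transport_mx (y x) @[x --> F] --> transport_mx yl.
Proof.
move=> /cvg_mxP yyl; apply/cvg_mxP => i j.
rewrite transport_mxE; under eq_fun do rewrite transport_mxE.
case: ifP => _; last exact: cvg_cst.
apply: cvgMn; rewrite mxE; under eq_fun do rewrite mxE; exact: yyl.
Qed.

Lemma cvg_source (f : 'I_Nt -> 'cV[R]_n) (u : T -> 'cV[R]_n) (ul : 'cV[R]_n) :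
  u @ F --> ul -> source f (u x) @[x --> F] --> source f ul.
Proof.
move=> uul; apply/cvg_mxP => i j.
rewrite mxE; under eq_fun do rewrite mxE.
case: (_ == 0)%N; last exact: cvg_cst.
exact: (cvg_mxP _ _).1 (cvgZl_tmp uul) _ _.
Qed.

Lemma cvg_state_op (f : 'I_Nt -> 'cV[R]_n) (y : T -> state R n Nt)
    (u : T -> 'cV[R]_n) (yl : state R n Nt) (ul : 'cV[R]_n) :
  y @ F --> yl -> u @ F --> ul ->
  state_op f (y x) (u x) @[x --> F] --> state_op f yl ul.
Proof.
move=> yyl uul; apply: cvgB; last exact: cvg_source.
apply: cvgD; first by apply: cvg_mulmx; first exact: cvg_cst.
apply: cvg_mulmx; first exact: cvg_transport_mx.
by apply: cvg_mulmx; first exact: cvg_cst.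
Qed.

Variables (mo no : nat).

Lemma cvg_cost (phi : R -> R)
    (Sobs : 'M[R]_(mo, no * Nt)) (H : 'M[R]_(no * Nt, \sum_(j < Nt) n))
    (z : 'cV[R]_mo) (Rcov : 'M[R]_mo) (ub : 'cV[R]_n) (Bcov : 'M[R]_n)
    (alpha beta mu : R)
    (y : T -> state R n Nt) (u : T -> 'cV[R]_n) (w : T -> 'cV[R]_(n.-1))
    (yl : state R n Nt) (ul : 'cV[R]_n) (wl : 'cV[R]_(n.-1)) :
  continuous phi -> y @ F --> yl -> u @ F --> ul -> w @ F --> wl ->
  cost phi Sobs H z Rcov ub Bcov alpha beta mu (y x) (u x) (w x) @[x --> F] -->
  cost phi Sobs H z Rcov ub Bcov alpha beta mu yl ul wl.
Proof.
move=> cphi yyl uul wwl.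
have mulc k l (A : 'M[R]_(k, l)) (v : T -> 'cV[R]_l) (vl : 'cV[R]_l) :
    v @ F --> vl -> A *m v x @[x --> F] --> A *m vl.
  by move=> ?; apply: cvg_mulmx => //; exact: cvg_cst.
have sumc k (v : T -> 'I_k -> R) (vl : 'I_k -> R) :
    (forall i, v x i @[x --> F] --> vl i) ->
    \sum_i phi (v x i) @[x --> F] --> \sum_i phi (vl i).
  move=> vvl; apply: cvg_big => [|i _]; first exact: add_continuous.
  exact: (cvg_comp _ _ (vvl i) (cphi _)).
apply: cvgD; first apply: cvgD; first apply: cvgD; first apply: cvgD.
- apply: cvgM; first exact: cvg_cst; apply: cvg_quadratic_form.
  by apply: cvgB; [exact: mulc | exact: cvg_cst].
- apply: cvgM; first exact: cvg_cst.
  exact: (cvg_mxP _ _).1 (cvg_mulmx (cvg_trmx wwl) wwl) 0 0.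
- apply: cvgM; first exact: cvg_cst; apply: cvg_quadratic_form.
  by apply: cvgB; [| exact: cvg_cst].
- apply: cvgM; first exact: cvg_cst; apply: sumc => i.
  apply: cvgB; first exact: (cvg_mxP _ _).1 (mulc _ _ _ _ _ uul) i 0.
  exact: (cvg_mxP _ _).1 wwl i 0.
- apply: cvgM; first exact: cvg_cst; apply: sumc => i.
  exact: (cvg_mxP _ _).1 (mulc _ _ _ _ _ wwl) i 0.
Qed.

End continuity.

(** * Bounds on approximate minimizers *)

Lemma frequently_le_of_not_cvgy (R : realType) (x : nat -> R) :
  ~ (x @ \oo --> +oo) ->
  exists A, forall N, exists2 k, (N < k)%N & x k <= A.
Proof.
move=> hx; apply: contrapT => /forallNP hA; apply: hx; apply/cvgryPge => A.
have /existsNP[N hN] := hA A; exists N.+1 => // k /= Nk.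
by rewrite leNgt; apply/negP => /ltW xA; apply: hN; exists k.
Qed.

Lemma norm_le_of_sqr (R : realType) (x a : R) : x ^+ 2 <= a -> `|x| <= a + 1.
Proof.
rewrite -real_normK ?num_real//; set t := `|x| => ta.
have : 0 <= (t - 1) ^+ 2 by exact: sqr_ge0.
have : 0 <= t by exact: normr_ge0.
nra.
Qed.

Lemma mx_entry_le_norm (R : realType) (m n : nat) (M : 'M[R]_(m, n)) i j :
  `|M i j| <= `|M|.
Proof.
rewrite [leRHS]/Num.norm/= mx_normrE.
exact: (le_bigmax _ (fun ij => `|M ij.1 ij.2|) (i, j)).
Qed.

Lemma dot_self_ge (R : realType) (k : nat) (w : 'cV[R]_k) i : w i 0 ^+ 2 <= (w^T *m w) 0 0.
Proof.
rewrite mxE (bigD1 i)//= mxE -expr2 lerDl sumr_ge0// => j _.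
by rewrite mxE -expr2 sqr_ge0.
Qed.

Section coercivity.
Context {R : realType} {n Nt mo no : nat}.
Variables (Sobs : 'M[R]_(mo, no * Nt)) (H : 'M[R]_(no * Nt, \sum_(j < Nt) n)).
Variables (z : 'cV[R]_mo) (Rcov : 'M[R]_mo) (ub : 'cV[R]_n) (Bcov : 'M[R]_n).
Variables (alpha beta mu : R).
Hypotheses (hR : sym_posdef Rcov) (hB : sym_posdef Bcov).
Hypotheses (halpha : 0 < alpha) (hbeta : 0 < beta) (hmu : 0 < mu).

Let J := cost Num.norm Sobs H z Rcov ub Bcov alpha beta mu.

(** Every term of J is nonnegative, so each of the two quadratic terms in u and w
    is at most J; nothing similar holds for y, whose observation SHy may vanish. *)
Lemma cost_coercive y u w (M := J y u w) :
  (forall i, `|u i 0| <= Bcov i i * (2 * M) + 1 + `|ub i 0|) /\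
  (forall i, `|w i 0| <= 2 / mu * M + 1).
Proof.
have MJ : J y u w <= M by [].
move: MJ; rewrite /J /cost.
have := invmx_form_ge0 hR (Sobs *m H *m y - z).
have := invmx_form_ge0 hB (u - ub).
have ww0 : 0 <= (w^T *m w) 0 0.
  by rewrite mxE sumr_ge0// => i _; rewrite mxE -expr2 sqr_ge0.
have a0 : 0 <= alpha * \sum_(i < n.-1) `|(grad_fwd R n *m u) i 0 - w i 0|.
  by apply: mulr_ge0; [exact: ltW | apply: sumr_ge0].
have b0 : 0 <= beta * \sum_(i < n.-1) `|(grad_bwd R n *m w) i 0|.
  by apply: mulr_ge0; [exact: ltW | apply: sumr_ge0].
move: a0 b0; set a := alpha * _; set b := beta * _.
set p := (_ *m (Sobs *m H *m y - z)) 0 0.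
set q := (_ *m (u - ub)) 0 0 => a0 b0 q0 p0 MJ.
have mw0 : 0 <= mu / 2 * (w^T *m w) 0 0 by rewrite mulr_ge0// divr_ge0// ltW.
split=> i.
- have Bii : 0 <= Bcov i i by exact/ltW/sym_posdef_diag_gt0.
  have /norm_le_of_sqr ui : (u - ub) i 0 ^+ 2 <= Bcov i i * (2 * M).
    apply: le_trans (entry_sqr_le_invmx_form hB _ _) _.
    by apply: ler_wpM2l => //; rewrite -/q; lra.
  have -> : u i 0 = (u - ub) i 0 + ub i 0 by rewrite !mxE subrK.
  by apply: le_trans (ler_normD _ _) _; rewrite lerD2r.
- apply: norm_le_of_sqr; apply: le_trans (dot_self_ge w i) _.
  rewrite mulrAC ler_pdivlMr//; lra.
Qed.

End coercivity.

(** * Minimizers of the regularized problems *)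

(** The error is paid twice: once to pass from J to Jg at the minimizer, once to
    come back at the competitor. *)
Lemma quasi_minimizer (X : Type) (R : realType) (J Jg : X -> R) (P : X -> Prop)
    (e : R) (x x' : X) :
  (forall v, `|Jg v - J v| <= e) -> (forall v, P v -> Jg x <= Jg v) -> P x' ->
  J x <= J x' + 2 * e.
Proof.
move=> dJ xmin /xmin le_g.
have := dJ x; have := dJ x'; rewrite !ler_norml => /andP[_ h1] /andP[h2 _].
lra.
Qed.

Lemma huber_minimizer_quasi_minimizer (R : realType) (n Nt mo no : nat)
    (Sobs : 'M[R]_(mo, no * Nt)) (H : 'M[R]_(no * Nt, \sum_(j < Nt) n))
    (z : 'cV[R]_mo) (Rcov : 'M[R]_mo) (ub : 'cV[R]_n) (Bcov : 'M[R]_n)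
    (alpha beta mu : R)
    (J := fun phi => cost phi Sobs H z Rcov ub Bcov alpha beta mu)
    (feasible : state R n Nt -> 'cV[R]_n -> Prop) g y u w y' u' w' :
  0 < alpha -> 0 < beta -> 1 <= g ->
  global_solution (J (huber g)) feasible y u w -> feasible y' u' ->
  J Num.norm y u w <= J Num.norm y' u' w' + 2 * ((alpha + beta) * n.-1%:R * g^-1).
Proof.
move=> a0 b0 g1 [_ sol] feas.
pose uncurry3 (f : state R n Nt -> 'cV[R]_n -> 'cV[R]_(n.-1) -> R) v :=
  f v.1.1 v.1.2 v.2.
apply: (@quasi_minimizer _ _ (uncurry3 (J Num.norm)) (uncurry3 (J (huber g)))
  (fun v => feasible v.1.1 v.1.2) _ (y, u, w) (y', u', w')) => // v.
- by apply: cost_dist; [exact: ltW | exact: ltW | move=> t; exact: huber_dist].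
- exact: sol.
Qed.

Theorem theorem2 (R : realType) (n Nt mo no : nat)
    (hn : (0 < n)%N) (hNt : (0 < Nt)%N)
    (f : 'I_Nt -> 'cV[R]_n)
    (Sobs : 'M[R]_(mo, no * Nt)) (H : 'M[R]_(no * Nt, \sum_(j < Nt) n))
    (z : 'cV[R]_mo) (Rcov : 'M[R]_mo) (ub : 'cV[R]_n) (Bcov : 'M[R]_n)
    (alpha beta mu : R)
    (hR : sym_posdef Rcov) (hB : sym_posdef Bcov)
    (halpha : 0 < alpha) (hbeta : 0 < beta) (hmu : 0 < mu)
    (J := cost Num.norm Sobs H z Rcov ub Bcov alpha beta mu)
    (Jreg := fun g : R => cost (huber g) Sobs H z Rcov ub Bcov alpha beta mu)
    (feasible := fun y u => state_op f y u = 0)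
    (gamma : nat -> R) (hgamma : forall k, 0 < gamma k)
    (hgamma_oo : gamma @ \oo --> +oo)
    (ys : nat -> state R n Nt) (us : nat -> 'cV[R]_n)
    (ws : nat -> 'cV[R]_(n.-1))
    (hsol : forall k,
       global_solution (Jreg (gamma k)) feasible (ys k) (us k) (ws k))
    (hys : ~ (`|ys k| @[k --> \oo] --> +oo))
    (y : state R n Nt) (u : 'cV[R]_n) (w : 'cV[R]_(n.-1))
    (hopt : global_solution J feasible y u w) :
  (exists s : nat -> nat, {homo s : i j / (i < j)%N} /\
     exists (yl : state R n Nt) (ul : 'cV[R]_n) (wl : 'cV[R]_(n.-1)),
       global_solution J feasible yl ul wl /\
       (ys (s k), us (s k), ws (s k)) @[k --> \oo] --> (yl, ul, wl))
  /\
  ((forall y' u' w', global_solution J feasible y' u' w' ->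
      (y', u', w') = (y, u, w)) ->
   exists s : nat -> nat, {homo s : i j / (i < j)%N} /\
     (ys (s k), us (s k), ws (s k)) @[k --> \oo] --> (y, u, w)).
Proof.
have [A frequently_le] := frequently_le_of_not_cvgy hys.
have [N _ gamma_ge1] := (cvgryPge _).1 hgamma_oo 1.
(* Along s0 the states are bounded and gamma is large enough for huber_dist. *)
have [|s0 [s0_homo /all_and2 [ys_le gamma_s0]]] :=
    @increasing_extraction (fun k => `|ys k| <= A /\ 1 <= gamma k).
  move=> k; have [l kl yl] := frequently_le (maxn k N).
  exists l; first by apply: leq_ltn_trans kl; exact: leq_maxl.
  split=> //; apply: gamma_ge1 => /=; apply/ltnW.
  by apply: leq_ltn_trans kl; exact: leq_maxr.
pose c := (alpha + beta) * n.-1%:R.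
have c_ge0 : 0 <= c by rewrite mulr_ge0// addr_ge0 ?ltW.
have quasi k y' u' w' : 1 <= gamma k -> feasible y' u' ->
    J (ys k) (us k) (ws k) <= J y' u' w' + 2 * (c * (gamma k)^-1).
  move=> gk feas; exact: huber_minimizer_quasi_minimizer (hsol k) feas.
(* The bound comes from comparing with the feasible point (y, u, w). *)
pose M := J y u w + 2 * c.
have J_le k : J (ys (s0 k)) (us (s0 k)) (ws (s0 k)) <= M.
  apply: le_trans (quasi _ _ _ w (gamma_s0 k) hopt.1) _.
  rewrite lerD2l ler_wpM2l// ler_piMr// invf_le1//.
have coercive k := cost_coercive Sobs H z ub hR hB halpha hbeta hmu
  (ys (s0 k)) (us (s0 k)) (ws (s0 k)).
have [k i j|s1 s1_homo /cvg_ex[yl ys_cvg]] :=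
    @bounded_mx_subsequence R _ _ (fun k => ys (s0 k)) (fun _ _ => A).
  exact: le_trans (mx_entry_le_norm _ _ _) (ys_le k).
have [k i j|s2 s2_homo /cvg_ex[ul us_cvg]] :=
    @bounded_mx_subsequence R _ _ (fun k => us (s0 (s1 k)))
      (fun i _ => Bcov i i * (2 * M) + 1 + `|ub i 0|).
  rewrite ord1; apply: le_trans ((coercive _).1 i) _.
  rewrite !lerD2r; apply: ler_wpM2l; last by rewrite ler_wpM2l// J_le.
  exact/ltW/sym_posdef_diag_gt0.
have [k i j|s3 s3_homo /cvg_ex[wl ws_cvg]] :=
    @bounded_mx_subsequence R _ _ (fun k => ws (s0 (s1 (s2 k))))
      (fun _ _ => 2 / mu * M + 1).
  rewrite ord1; apply: le_trans ((coercive _).2 i) _.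
  by rewrite lerD2r ler_wpM2l ?J_le// divr_ge0// ltW.
pose s k := s0 (s1 (s2 (s3 k))).
have s_homo : {homo s : i j / (i < j)%N}.
  by move=> i j /s3_homo/s2_homo/s1_homo/s0_homo.
have {}ys_cvg : ys (s k) @[k --> \oo] --> yl.
  apply: (cvg_comp (s2 \o s3) _ _ ys_cvg).
  by apply: homo_ltn_cvg_infty => i j /s3_homo/s2_homo.
have {}us_cvg : us (s k) @[k --> \oo] --> ul.
  by apply: (cvg_comp s3 _ _ us_cvg); exact: homo_ltn_cvg_infty.
have {}ws_cvg : ws (s k) @[k --> \oo] --> wl by [].
have limit_sol : global_solution J feasible yl ul wl.
  split=> [|y' u' w' feas].
    have op_cvg : state_op f (ys (s k)) (us (s k)) @[k --> \oo]
        --> state_op f yl ul by exact: cvg_state_op.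
    have op0 : (fun k => state_op f (ys (s k)) (us (s k))) = fun=> 0.
      by apply/funext => k; exact: (hsol _).1.
    rewrite op0 in op_cvg.
    by apply: (cvg_unique (@norm_hausdorff _ _) op_cvg); exact: cvg_cst.
  have J_cvg : J (ys (s k)) (us (s k)) (ws (s k)) @[k --> \oo] --> J yl ul wl.
    by apply: cvg_cost => //; exact: norm_continuous.
  have err_cvg : J y' u' w' + 2 * (c * (gamma (s k))^-1) @[k --> \oo]
      --> J y' u' w' + 2 * (c * 0).
    apply: cvgD; first exact: cvg_cst.
    apply: cvgM; first exact: cvg_cst.
    apply: cvgM; first exact: cvg_cst.
    apply/gtr0_cvgV0; first by apply: nearW => k; exact: hgamma.
    by apply: (cvg_comp s _ _ hgamma_oo); exact: homo_ltn_cvg_infty.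
  rewrite -[leRHS]addr0 -(mulr0 2) -(mulr0 c).
  apply: ler_cvg_to J_cvg err_cvg _.
  by apply: nearW => k; exact: quasi (gamma_s0 _) feas.
have lim_cvg : (ys (s k), us (s k), ws (s k)) @[k --> \oo] --> (yl, ul, wl).
  exact: cvg_pair (cvg_pair ys_cvg us_cvg) ws_cvg.
split; first by exists s; split=> //; exists yl, ul, wl.
move=> uniq_sol; exists s; split=> //.
by rewrite -(uniq_sol _ _ _ limit_sol).
Qed.
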